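(* Let $G$ be a second countable locally compact group and let $a\in G$. Then the following are equivalent: (1) $a$ is an aperiodic element of $G$. (2) For any compact subset $K$ of $G$, there exists $N\in\mathbb{N}$ such that $K\cap Ka^n=\varnothing$ for all $n>N$. (3) $G$ has a terminal pair with respect to $a$.
   Context: Topological groups are not assumed Hausdorff; a locally compact group is a topological group whose topology is locally compact, and ''compact'' means that every open cover has a finite subcover. For $a\in G$ let $G(a)=\overline{\langle a\rangle}$ be the closure of the cyclic subgroup generated by $a$. The element $a$ is periodic if $G(a)$ is compact, and aperiodic if it is not periodic. A terminal pair of $G$ with respect to $a$ is a pair $(A,B)$ of disjoint closed subsets of $G$ such that for every compact subset $K\subseteq G$ one has $Ka^n\subseteq A$ and $Ka^{-n}\subseteq B$ for all sufficiently large $n$ (how large may depend on $K$). *)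

(* Defs.v *)
From HB Require Import structures.
From mathcomp Require Import all_boot.
From mathcomp Require Import all_classical topology.

Set Implicit Arguments.
Unset Strict Implicit.
Unset Printing Implicit Defensive.

Local Open Scope classical_set_scope.
Local Open Scope group_scope.

HB.mixin Record Group_isTopologicalGroup G of Topological G & Group G := {
  mulg_continuous : continuous (fun x : G * G => x.1 * x.2) ;
  invg_continuous : continuous (fun x : G => x^-1)
}.

#[short(type="topologicalGroupType")]
HB.structure Definition TopologicalGroup :=
  {G of Topological G & Group G & Group_isTopologicalGroup G}.

Section TopologicalGroupTheory.
Context {G : topologicalGroupType}.
Implicit Types (a x : G) (K A B : set G).

Definition cyclic_subgroup a : set G :=
  [set a ^+ n | n in [set: nat]] `|` [set a ^- n | n in [set: nat]].

Definition periodic a := compact (closure (cyclic_subgroup a)).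

Definition aperiodic a := ~ periodic a.

Definition rtranslate K x : set G := [set k * x | k in K].

Definition terminal_pair a A B :=
  [/\ closed A, closed B, A `&` B = set0 &
      forall K, compact K ->
        \forall n \near \oo,
          rtranslate K (a ^+ n) `<=` A /\ rtranslate K (a ^- n) `<=` B].

(* The library's [compact] is defined through filters. *)
Lemma compact_open_coverE : @compact G = @cover_compact G.
Proof.
pose G' : ptopologicalType := HB.pack (TopologicalGroup.sort G) (TopologicalGroup.class G) (isPointed.Build G 1).
exact: (@compact_cover G').
Qed.

(* The library's [locally_compact] asks for neighborhoods that are both compact
   and closed; in a topological group, Hausdorff or not, this is no stronger
   than asking for compact neighborhoods. *)
Lemma locally_compactE :
  locally_compact [set: G] <-> forall x, exists2 K, nbhs x K & compact K.
Proof.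
split=> [lcG x|cG x _].
  have [K] := lcG x I; rewrite /within/= => xK [cK _].
  by exists K => //; apply: filterS xK => y; exact.
have [K xK cK] := cG x.
have [[U W] /= [xU W1] UWK] : nbhs (x, 1) [set p : G * G | K (p.1 * p.2)].
  by apply: (mulg_continuous (x, 1) K); rewrite /= mulg1.
have clUK : closure U `<=` K.
  move=> y clUy.
  have : nbhs y [set u : G | W (u^-1 * y)].
    have cvg_y : (fun u : G => u^-1 * y) @ y --> (1 : G).
      rewrite -[X in _ --> X](mulVg y).
      apply: (@continuous2_cvg _ _ _ _ _ _ _ _ (fun u v : G => u * v)).
      - exact: (mulg_continuous (y^-1, y)).
      - exact: invg_continuous.
      - exact: cvg_cst.
    exact: cvg_y.
  by move=> /clUy[u [Uu Wu]]; rewrite -[y](mulVKg u); exact: (UWK (u, u^-1 * y)).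
exists (closure U); last split.
- by apply: filterS xU => y Uy _; exact: subset_closure.
- by apply: subclosed_compact cK clUK; exact: closed_closure.
- exact: closed_closure.
Qed.

End TopologicalGroupTheory.

(* Main.v *)
Require Import Defs.
From mathcomp Require Import all_boot.
From mathcomp Require Import all_classical topology.

(** If the powers of [a] do not leave every compact set, they return arbitrarily
    late to every neighborhood of the identity, and a compact neighborhood then
    bounds the return times uniformly, so that [a] is periodic. If they do leave
    every compact set, let [K i] be an exhaustion by closed compact sets and let
    [K i] and [K i a^n] be disjoint for [n > N i]: the union of the [K i a^n] and
    the union of the [K i a^-n], over [n > N i], form a terminal pair. Finally, if
    the closure [H] of the powers of [a] is compact, then [1] is in both [H a^n]
    and [H a^-n] for all [n], which rules out a terminal pair. *)

Set Implicit Arguments.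
Unset Strict Implicit.
Unset Printing Implicit Defensive.

Local Open Scope classical_set_scope.
Local Open Scope group_scope.

Section TopologicalGroup.
Context {G : topologicalGroupType}.
Implicit Types (a g h x y : G) (A B C K U V : set G).

(** * Continuity of translations and of division *)

Lemma mulgl_continuous g : continuous (fun x : G => g * x).
Proof.
move=> x; apply: (@continuous2_cvg _ _ _ _ _ _ _ _ (fun u v : G => u * v)).
- exact: (mulg_continuous (g, x)).
- exact: cvg_cst.
- exact: cvg_id.
Qed.

Lemma mulgr_continuous g : continuous (fun x : G => x * g).
Proof.
move=> x; apply: (@continuous2_cvg _ _ _ _ _ _ _ _ (fun u v : G => u * v)).
- exact: (mulg_continuous (x, g)).
- exact: cvg_id.
- exact: cvg_cst.
Qed.

Lemma divgl_continuous : continuous (fun p : G * G => p.1^-1 * p.2).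
Proof.
move=> p; apply: (@continuous2_cvg _ _ _ _ _ _ _ _ (fun u v : G => u * v)).
- exact: (mulg_continuous (p.1^-1, p.2)).
- apply: (@continuous_comp _ _ _ fst (fun x : G => x^-1)); first exact: cvg_fst.
  exact: invg_continuous.
- exact: cvg_snd.
Qed.

Lemma rtranslateE K x : rtranslate K x = [set y | K (y * x^-1)].
Proof.
apply/seteqP; split=> [_ [k Kk <-]|y Ky] /=; first by rewrite mulgK.
by exists (y * x^-1) => //; rewrite mulgVK.
Qed.

Lemma closed_rtranslate K x : closed K -> closed (rtranslate K x).
Proof.
move=> cK; rewrite rtranslateE; apply: (preimage_closed _ cK) => y _.
exact: mulgr_continuous.
Qed.

Lemma nbhs_divgl x U : nbhs (1 : G) U ->
  exists2 V, nbhs x V & forall y z, V y -> V z -> U (y^-1 * z).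
Proof.
move=> U1; have [[V W] /= [xV xW] VWU] :
    nbhs (x, x) [set p : G * G | U (p.1^-1 * p.2)].
  by apply: (@divgl_continuous (x, x) U); rewrite /= mulVg.
exists (V `&` W); first exact: filterI.
by move=> y z [Vy _] [_ Wz]; exact: (VWU (y, z)).
Qed.

(** * Recurrence of powers and periodicity *)

(* If [a^n] were eventually outside [U], any compact set would have a finite
   cover by sets [V] with [V^-1 V] inside [U], none of which can contain two
   powers of [a] with far apart exponents. *)
Lemma expg_recurrent a C U : compact C -> nbhs (1 : G) U ->
  (forall N, exists2 n, (N < n)%N & C (a ^+ n)) ->
  forall N, exists2 n, (N <= n)%N & U (a ^+ n).
Proof.
move=> /compact_near_coveringP cC U1 rec N; apply: contrapT => Ufree.
suff [M _ CM] : \forall n \near \oo, C `<=` [set y | y <> a ^+ n].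
  by have [n Mn /(CM n (ltnW Mn))] := rec M.
apply: cC => x _; have [V xV VU] := nbhs_divgl x U1.
have [[m Vm]|noV] := pselect (exists m, V (a ^+ m)); last first.
  exists (V, setT) => /=; first by split=> //; exact: filterT.
  by move=> [y n] [/= Vy _] yE; apply: noV; exists n; rewrite -yE.
exists (V, [set n | (m + N <= n)%N]) => /=.
  by split=> //; exact: nbhs_infty_ge.
move=> [y n] [/= Vy mNn] yE; apply: Ufree; exists (n - m)%N.
  by rewrite leq_subRL ?(leq_trans (leq_addr _ _) mNn).
by rewrite -[a ^+ (n - m)](mulKg (a ^+ m)) -expgnDr; apply: VU => //;
  rewrite subnKC ?(leq_trans (leq_addr _ _) mNn) // -yE.
Qed.


Lemma cyclic_subgroupV a : cyclic_subgroup a^-1 = cyclic_subgroup a.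
Proof.
rewrite /cyclic_subgroup setUC; congr (_ `|` _); apply/seteqP; split=> _ [n _ <-];
  by exists n; rewrite // expVgn ?invgK.
Qed.

Lemma expg_closure_cyclic_subgroup a n : closure (cyclic_subgroup a) (a ^+ n).
Proof. by apply: subset_closure; left; exists n. Qed.

Lemma expVg_closure_cyclic_subgroup a n : closure (cyclic_subgroup a) (a ^- n).
Proof. by apply: subset_closure; right; exists n. Qed.

Lemma cyclic_subgroup_mulXl a m x :
  cyclic_subgroup a x -> cyclic_subgroup a (a ^+ m * x).
Proof.
move=> [|] [n _ <-]; first by left; exists (m + n)%N; rewrite // expgnDr.
have [nm|/ltnW mn] := leqP n m; first by left; exists (m - n)%N; rewrite // expgnFr.
by right; exists (n - m)%N; rewrite // expgnFr // invgF.
Qed.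

Lemma closure_cyclic_subgroup_mulXl a m x :
  closure (cyclic_subgroup a) x -> closure (cyclic_subgroup a) (a ^+ m * x).
Proof.
move=> clx U /(@mulgl_continuous (a ^+ m)) /clx[y [ay Uy]].
by exists (a ^+ m * y); split => //; exact: cyclic_subgroup_mulXl.
Qed.

(* A power of [a] close to [h], followed by a large power returning near [1]. *)
Lemma expg_recurrent_closure a U h :
  (forall V, nbhs (1 : G) V -> forall N, exists2 n, (N <= n)%N & V (a ^+ n)) ->
  nbhs (1 : G) U -> closure (cyclic_subgroup a) h ->
  exists2 n, (0 < n)%N & U (a ^- n * h).
Proof.
move=> rec U1 clh.
have [[V W] /= [V1 W1] VWU] : nbhs (1 : G, 1 : G) [set p : G * G | U (p.1^-1 * p.2)].
  by apply: (@divgl_continuous (1, 1) U); rewrite /= invg1 mulg1.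
have : nbhs h [set y | W (y^-1 * h)].
  have : nbhs (h, h) [set p : G * G | W (p.1^-1 * p.2)].
    by apply: (@divgl_continuous (h, h) W); rewrite /= mulVg.
  by move=> [[P Q] /= [hP hQ] PQ]; apply: filterS hP => y Py;
    apply: (PQ (y, h)); split=> //; exact: nbhs_singleton.
move=> /clh[_ [[] [m _ <-]]] /= Wh.
  have [n n0 Vn] := rec _ V1 1%N.
  exists (n + m)%N; first by rewrite addn_gt0 n0.
  by rewrite addnC expgnDr invgM -mulgA; exact: (VWU (_, _)).
(* Here the power near [h] is [a ^- m]; a return time beyond [m] keeps the exponent [n - m]
   positive. *)
have [n mn Vn] := rec _ V1 m.+1.
exists (n - m)%N; first by rewrite subn_gt0.
rewrite expgnFr ?(ltnW mn)// invgF.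
have -> : a ^+ m / a ^+ n * h = (a ^+ n)^-1 * ((a ^- m)^-1 * h).
  rewrite invgK mulgA; congr (_ * _).
  exact/esym/commuteX/commute_sym/commuteV/commuteX/commute_refl.
exact: (VWU (_, _)).
Qed.

(* With [V] a compact neighborhood of [1] and [H] the closure of the powers of
   [a], compactness yields [N] such that [V `&` H] is contained in the union of
   the [a ^+ n * V], [0 < n <= N]. For [h] in [H], the least [m] such that
   [a ^+ m * h] is in [V] is then less than [N], so that [H] is contained in the
   union of the [a ^- m * V], [m < N]. *)
Lemma recurrent_periodic a : locally_compact [set: G] ->
  (forall U, nbhs (1 : G) U -> forall N, exists2 n, (N <= n)%N & U (a ^+ n)) ->
  periodic a.
Proof.
move=> /locally_compactE/(_ 1)[V V1 cV] rec.
set H := closure (cyclic_subgroup a).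
have recV U : nbhs (1 : G) U -> forall N, exists2 n, (N <= n)%N & U (a^-1 ^+ n).
  move=> U1 N; have U1V : nbhs (1 : G) [set x | U x^-1].
    by apply: (@invg_continuous _ 1 U); rewrite invg1.
  by have [n Nn Un] := rec _ U1V N; exists n => //; rewrite expVgn.
have [N _ VN] : \forall N \near \oo,
    V `&` H `<=` [set y | exists2 n, (0 < n <= N)%N & V (a ^- n * y)].
  have /compact_near_coveringP := compact_closedI cV (@closed_closure _ (cyclic_subgroup a)).
  apply => x [_ Hx].
  (* Aiming at the interior of [V] keeps [a ^- n * y] in [V] for all [y] near [x]. *)
  have [n n0 Vx] := expg_recurrent_closure rec (nbhs_interior V1) Hx.
  exists ([set y | V (a ^- n * y)], [set N | (n <= N)%N]) => /=.
    by split; [exact: (@mulgl_continuous (a ^- n) x V) | exact: nbhs_infty_ge].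
  by move=> [y N] [/= Vy nN]; exists n; rewrite ?n0.
pose F m := [set a ^- m * v | v in V].
have cF : compact (\big[setU/set0]_(m < N) F m).
  apply: bigsetU_compact => m _; apply: continuous_compact cV.
  exact/continuous_subspaceT/mulgl_continuous.
apply: subclosed_compact cF _; first exact: closed_closure.
move=> h Hh; rewrite -bigcup_mkord.
(* Recurrence of [a^-1], whose powers have the same closure, brings some [a ^+ m * h] into [V]. *)
have exm : exists m, `[< V (a ^+ m * h) >].
  rewrite -cyclic_subgroupV in Hh.
  have [m _] := expg_recurrent_closure recV V1 Hh.
  by rewrite expVgn invgK => Vm; exists m; apply/asboolP.
have [m /asboolP Vm minm] := ex_minnP exm.
have [n /andP[n0 nN] Vn] : exists2 n, (0 < n <= N)%N & V (a ^- n * (a ^+ m * h)).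
  by apply: (VN N (leqnn N)); split=> //; exact: closure_cyclic_subgroup_mulXl.
exists m; last by exists (a ^+ m * h); rewrite ?mulKg.
(* If [n <= m], then [m - n] is a smaller exponent with the same property, because [0 < n]. *)
apply: leq_trans nN; rewrite ltnNge; apply/negP => nm.
suff /minm : `[< V (a ^+ (m - n) * h) >] by rewrite leqNgt ltn_subrL n0 (leq_trans n0 nm).
apply/asboolP.
by move: Vn; rewrite -{1}(subnKC nm) expgnDr -mulgA mulKg.
Qed.

(** [K] meets [K a^n] only if [a^n] lies in the compact set [C] of all quotients [k^-1 k'] with [k],
    [k'] in [K]. If this happens for arbitrarily large [n], the powers of [a] recur to [1] and [a]
    is periodic. *)
Lemma aperiodic_escape a K : locally_compact [set: G] -> aperiodic a ->
  compact K -> exists N : nat, forall n : nat, (N < n)%N ->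
    K `&` rtranslate K (a ^+ n) = set0.
Proof.
move=> lcG aper cK; apply: contrapT => noN; apply: aper.
pose C := [set p.1^-1 * p.2 | p in K `*` K].
have cC : compact C.
  apply: continuous_compact (compact_setX cK cK).
  exact/continuous_subspaceT/divgl_continuous.
apply: recurrent_periodic => // U U1 N; apply: expg_recurrent cC U1 _ N => {}N.
apply: contrapT => noC; apply: noN; exists N => n Nn.
rewrite -subset0 => x [Kx [k Kk kE]]; apply: noC; exists n => //.
by exists (k, k * a ^+ n); rewrite /= ?mulKg //; split=> //=; rewrite kE.
Qed.

(** * Exhaustion by closed compact sets *)

Lemma compact_exhaustion : locally_compact [set: G] -> @second_countable G ->
  exists K : nat -> set G,
    [/\ forall i, compact (K i), forall i, closed (K i),
        forall i j, (i <= j)%N -> K i `<=` K j,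
        forall x, exists i, nbhs x (K i) &
        forall C, compact C -> exists i, C `<=` K i].
Proof.
move=> lcG [B /pfcard_geP cB [Bopen Bbasis]].
have [B0|[e]] := cB.
  by have [U [+ _] _] := Bbasis 1 _ filterT; rewrite B0.
(* [L n] is the closure of the [n]-th basic open set if that closure is compact, and empty
   otherwise. Basic sets inside closed compact neighborhoods are of the first kind, so the interiors
   of the finite unions [K i] cover [G]. *)
pose L n := [set x | compact (closure (e n)) /\ closure (e n) x].
have LE n : compact (closure (e n)) -> L n = closure (e n).
  by move=> cn; apply/seteqP; split=> [x []|x].
have L0 n : ~ compact (closure (e n)) -> L n = set0.
  by move=> cn; rewrite -subset0 => x [].
have cL n : compact (L n).
  have [cn|cn] := pselect (compact (closure (e n))); first by rewrite LE.
  by rewrite L0 //; exact: compact0.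
have clL n : closed (L n).
  have [cn|cn] := pselect (compact (closure (e n))).
    by rewrite LE //; exact: closed_closure.
  by rewrite L0 //; exact: closed0.
pose K i := \bigcup_(n < i) L n.
have Kx x : exists i, nbhs x (K i).
  have [C] := lcG x I; rewrite /within /= => xC [cC clC].
  have xC' : nbhs x C by apply: filterS xC => y; exact.
  have [U [BU Ux] UC] := Bbasis x _ xC'.
  have [n _ enU] := @surj _ _ _ _ e U BU.
  exists n.+1; have : nbhs x U by apply: open_nbhs_nbhs; split=> //; exact: Bopen.
  apply: filterS => y Uy; exists n => /=; first exact: ltnSn.
  rewrite LE ?enU; first exact: subset_closure.
  apply: (subclosed_compact _ cC); first exact: closed_closure.
  by apply: subset_trans clC; exact: closureS.
have KS i j : (i <= j)%N -> K i `<=` K j.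
  by move=> ij x [n ni Lx]; exists n => //; exact: leq_trans ij.
exists K; split=> // [i|i|C /compact_near_coveringP cC].
- by rewrite /K bigcup_mkord; apply: bigsetU_compact.
- by apply: closed_bigcup => // ; exact: finite_II.
suff [i _ Ci] : \forall i \near \oo, C `<=` K i by exists i; exact: Ci (leqnn i).
apply: cC => x _; have [i xi] := Kx x.
exists (K i, [set j | (i <= j)%N]) => /=; first by split=> //; exact: nbhs_infty_ge.
by move=> [y j] [/= Ky ij]; exact: KS Ky.
Qed.

(** * Construction of terminal pairs *)

Section TerminalPair.
Context (K : nat -> set G) (N : nat -> nat).
Hypotheses (clK : forall i, closed (K i)).
Hypothesis KS : forall i j, (i <= j)%N -> K i `<=` K j.
Hypothesis Kx : forall x, exists i, nbhs x (K i).

(** Taking [b] to be [a] and [a^-1] gives the two halves of the pair. *)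
Definition terminal_set b :=
  [set x | exists i n, (N i < n)%N /\ rtranslate (K i) (b ^+ n) x].

(* The family of the [K i * b ^+ n], [N i < n], is locally finite: such a
   translate meets [K j] only if [i <= j] and [n <= N j]. *)
Lemma closed_terminal_set b :
  (forall i n, (N i < n)%N -> K i `&` rtranslate (K i) (b ^+ n) = set0) ->
  closed (terminal_set b).
Proof.
move=> KN x clx; have [j xj] := Kx x.
pose D := [set p : nat * nat | [/\ (p.1 < j.+1)%N, (p.2 < (N j).+1)%N & (N p.1 < p.2)%N]].
(* [F] is a finite union of closed translates that contains every point of [terminal_set b] in the
   neighborhood [K j] of [x]. *)
pose F := \bigcup_(p in D) rtranslate (K p.1) (b ^+ p.2).
have clF : closed F.
  apply: closed_bigcup => [|p _]; last exact: closed_rtranslate.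
  apply: (@sub_finite_set _ _ (`I_(j.+1) `*` `I_((N j).+1))).
    by move=> [i n] [].
  by apply: finite_setX; exact: finite_II.
suff: F x by move=> [[i n] [_ _ Nn] bx]; exists i, n.
apply: clF => U xU; have [y [[i [n [Nin biy]]] [Uy Ky]]] := clx _ (filterI xU xj).
exists y; split=> //; exists (i, n) => //.
have [ij|/ltnW ji] := leqP i j; last first.
  have : (K i `&` rtranslate (K i) (b ^+ n)) y by split=> //; exact: KS Ky.
  by rewrite KN.
split=> //=; rewrite ltnS leqNgt; apply/negP => Njn.
have : (K j `&` rtranslate (K j) (b ^+ n)) y.
  by split=> //; case: biy => k Kk <-; exists k => //; exact: KS Kk.
by rewrite KN.
Qed.

(** A common point [k b^n = l b^-m] gives [l = k b^(n+m)]. For [s] the larger index, [k] and [l] are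
    both in [K s], and [n + m] exceeds [N s], which is [N i] or [N j]. *)
Lemma disjoint_terminal_set b :
  (forall i n, (N i < n)%N -> K i `&` rtranslate (K i) (b ^+ n) = set0) ->
  terminal_set b `&` terminal_set b^-1 = set0.
Proof.
move=> KN; rewrite -subset0 => x [[i [n [Nin [k Kk kx]]]] [j [m [Njm [l Kl lx]]]]].
pose s := maxn i j.
have Ns : (N s < n + m)%N.
  by rewrite /s; case: (leqP i j) => _; [exact: ltn_addl|exact: ltn_addr].
have : (K s `&` rtranslate (K s) (b ^+ (n + m))) l; last by rewrite KN.
split; first exact: KS (leq_maxr _ _) _ Kl.
exists k; first exact: KS (leq_maxl _ _) _ Kk.
by rewrite expgnDr mulgA kx -lx expVgn mulgVK.
Qed.

End TerminalPair.

(** Right translation by [a^n] carries the second intersection into the first. *)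
Lemma rtranslate_expg_escapeV a K n : K `&` rtranslate K (a ^+ n) = set0 ->
  K `&` rtranslate K (a^-1 ^+ n) = set0.
Proof.
rewrite -!subset0 => Ka x [Kx [k Kk kx]]; apply: (Ka k); split=> //.
by exists x; rewrite // -kx expVgn mulgVK.
Qed.

Lemma escape_terminal_pair a : locally_compact [set: G] -> @second_countable G ->
  (forall K, compact K -> exists N : nat, forall n : nat, (N < n)%N ->
    K `&` rtranslate K (a ^+ n) = set0) ->
  exists A B, terminal_pair a A B.
Proof.
move=> lcG scG esc; have [K [cK clK KS Kx KC]] := compact_exhaustion lcG scG.
have [N KN] := choice (fun i => esc _ (cK i)).
exists (terminal_set K N a), (terminal_set K N a^-1); split.
- exact: closed_terminal_set.
- by apply: closed_terminal_set => // i n Nin; exact/rtranslate_expg_escapeV/KN.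
- exact: disjoint_terminal_set.
move=> C /KC[i Ci]; exists (N i).+1 => // n Nn; split=> _ [k Ck <-].
  by exists i, n; split=> //; exists k => //; exact: Ci.
by exists i, n; split=> //; exists k; [exact: Ci | rewrite expVgn].
Qed.

Lemma terminal_pair_aperiodic a A B : terminal_pair a A B -> aperiodic a.
Proof.
move=> [_ _ AB term] /term[n _ /(_ n (leqnn n))[nA nB]].
suff : (A `&` B) 1 by rewrite AB.
split; [apply: nA; exists (a ^- n) | apply: nB; exists (a ^+ n)].
- exact: expVg_closure_cyclic_subgroup.
- by rewrite mulVg.
- exact: expg_closure_cyclic_subgroup.
- by rewrite mulgV.
Qed.

End TopologicalGroup.

Theorem theorem2p15 (G : topologicalGroupType) (a : G) :
  locally_compact [set: G] -> @second_countable G ->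
  [<-> aperiodic a;
       forall K : set G, compact K ->
         exists N : nat, forall n : nat, (N < n)%N ->
           K `&` rtranslate K (a ^+ n) = set0;
       exists A B : set G, terminal_pair a A B].
Proof.
move=> lcG scG; tfae => [aper K||[A [B]]].
- exact: aperiodic_escape.
- exact: escape_terminal_pair.
- exact: terminal_pair_aperiodic.
Qed.
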